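(* Let $\mathcal{V}$ be a Euclidean Jordan algebra of rank $n$. Fix a Jordan frame $\{e_1,e_2,\ldots,e_n\}$ in $\mathcal{V}$, relative to which Schur products $A\bullet x$ are taken. For a given real symmetric $n\times n$ matrix $C$, let $T:\mathcal{V}\to\mathcal{V}$ be the linear transformation $T(x):=C\bullet x$. Consider the following statements: (a) $C$ is a correlation matrix. (b) $T$ is doubly stochastic. (c) $T(x)\prec x$ for all $x\in\mathcal{V}$. Then (a) $\Rightarrow$ (b) $\Leftrightarrow$ (c). Moreover, if $\mathcal{V}$ is simple, then (c) $\Rightarrow$ (a).
   Context: A Euclidean Jordan algebra $(\mathcal{V},\circ,\langle\cdot,\cdot\rangle)$ is a finite-dimensional real inner product space with a commutative bilinear product $\circ$ satisfying $x\circ(x^2\circ y)=x^2\circ(x\circ y)$ and $\langle x\circ y,z\rangle=\langle y,x\circ z\rangle$, with unit element $e$. It is simple if it is nonzero and has no nontrivial ideals. A Jordan frame is a set $\{e_1,\ldots,e_n\}$ of primitive idempotents with $e_i\circ e_j=0$ for $i\ne j$ and $\sum_i e_i=e$; all Jordan frames have the same number $n$ of elements, the rank of $\mathcal{V}$. Spectral decomposition: every $x\in\mathcal{V}$ can be written $x=\sum_{i=1}^n x_ie_i$ for some Jordan frame $\{e_1,\ldots,e_n\}$ and real numbers $x_i$, called the eigenvalues of $x$ (uniquely determined with multiplicity). $\lambda(x)\in\mathbb{R}^n$ is the vector of eigenvalues of $x$ in decreasing order, and $\operatorname{tr}(x)$ is the sum of the eigenvalues. We write $x\ge 0$ if all eigenvalues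 are nonnegative. The inner product on $\mathcal{V}$ is assumed to be $\langle x,y\rangle=\operatorname{tr}(x\circ y)$. Majorization: for $p,q\in\mathbb{R}^n$, $p\prec q$ means $\sum_{i=1}^k p_i^\downarrow\le\sum_{i=1}^k q_i^\downarrow$ for all $1\le k\le n$ with equality for $k=n$, where $p^\downarrow$ is the decreasing rearrangement of $p$. For $x,y\in\mathcal{V}$, $x\prec y$ means $\lambda(x)\prec\lambda(y)$. Peirce decomposition and Schur product: given a Jordan frame $\{e_1,\ldots,e_n\}$, $\mathcal{V}$ is the orthogonal direct sum $\mathcal{V}=\sum_{i\le j}\mathcal{V}_{ij}$ with $\mathcal{V}_{ii}=\{x: x\circ e_i=x\}=\mathbb{R}e_i$ and $\mathcal{V}_{ij}=\{x: x\circ e_i=\tfrac12x=x\circ e_j\}$ for $i<j$. Writing $x=\sum_{i\le j}x_{ij}$ with $x_{ij}\in\mathcal{V}_{ij}$, for a real symmetric $n\times n$ matrix $A=[a_{ij}]$ the Schur product is $A\bullet x:=\sum_{i\le j}a_{ij}x_{ij}$. A correlation matrix is a real symmetric positive semidefinite matrix all of whose diagonal entries equal $1$. A linear transformation $T:\mathcal{V}\to\mathcal{V}$ is doubly stochastic if it is positive ($x\ge0\Rightarrow T(x)\ge0$), unital ($T(e)=e$), and trace preserving ($\operatorname{tr}(T(x))=\operatorname{tr}(x)$ for all $x$). *)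

(* Defs.v *)
From HB Require Import structures.
From mathcomp Require Import all_boot all_order all_algebra.
From mathcomp Require Import boolp classical_sets reals.

Set Implicit Arguments.
Unset Strict Implicit.
Unset Printing Implicit Defensive.

Import Order.TTheory GRing.Theory Num.Theory.
Local Open Scope ring_scope.

(* The space {0}, of rank 0, is allowed. *)
Record euclidean_jordan (R : realType) (V : vectType R) := EuclideanJordan {
  jmul : {bilinear V -> V -> V};
  jdot : {dot V for idfun};
  jone : V;
  jmulC : forall x y, jmul x y = jmul y x;
  jmul_jordan : forall x y,
    jmul x (jmul (jmul x x) y) = jmul (jmul x x) (jmul x y);
  jdot_assoc : forall x y z, jdot (jmul x y) z = jdot y (jmul x z);
  jmul1 : forall x, jmul jone x = x }.

Section Jordan.
Variables (R : realType) (V : vectType R) (J : euclidean_jordan V).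

Definition ideal (I : {vspace V}) : Prop :=
  forall x y, x \in I -> jmul J x y \in I.

Definition simple : Prop :=
  (fullv : {vspace V}) <> 0%VS /\
  forall I : {vspace V}, ideal I -> I = 0%VS \/ I = fullv.

Definition idempotent (c : V) : Prop := jmul J c c = c.

Definition primitive (c : V) : Prop :=
  [/\ idempotent c, c <> 0 &
      forall a b, idempotent a -> idempotent b -> c = a + b ->
        a = 0 \/ b = 0].

(* The members of such a family are automatically pairwise distinct, being
   nonzero idempotents with pairwise zero products. *)
Definition jordan_frame n (e : 'I_n -> V) : Prop :=
  [/\ forall i, primitive (e i),
      forall i j, i != j -> jmul J (e i) (e j) = 0 &
      \sum_i e i = jone J].

(* All Jordan frames have the same number of elements, so the choice made by
   [xget] is immaterial; likewise for [eigenvalues] below. *)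
Definition jrank : nat :=
  xget 0%N [set n | exists e : 'I_n -> V, jordan_frame e]%classic.

Definition eigenvalues (x : V) : jrank.-tuple R :=
  xget [tuple 0 : R | _ < jrank]
    [set s : jrank.-tuple R | sorted >=%R s /\
      exists2 e : 'I_jrank -> V,
        jordan_frame e & x = \sum_i tnth s i *: e i]%classic.

Definition jtr (x : V) : R := \sum_i tnth (eigenvalues x) i.

Definition jnneg (x : V) : Prop := forall i, 0 <= tnth (eigenvalues x) i.

Definition majorized n (p q : n.-tuple R) : Prop :=
  let psum (s : seq R) k := \sum_(0 <= i < k) (sort >=%R s)`_i in
  (forall k, (1 <= k <= n)%N -> psum p k <= psum q k) /\ psum p n = psum q n.

Definition jmajorized (x y : V) : Prop :=
  majorized (eigenvalues x) (eigenvalues y).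

Definition doubly_stochastic (T : {linear V -> V}) : Prop :=
  [/\ forall x, jnneg x -> jnneg (T x),
      T (jone J) = jone J &
      forall x, jtr (T x) = jtr x].

Definition peirce n (e : 'I_n -> V) (p : 'I_n * 'I_n) : {vspace V} :=
  let L i : 'End(V) := linfun (jmul J (e i)) in
  if p.1 == p.2 then passmx.leigenspace (L p.1) 1
  else (passmx.leigenspace (L p.1) 2^-1 :&: passmx.leigenspace (L p.2) 2^-1)%VS.

(* The sum is direct and equal to V when e is a Jordan frame; [sumv_pi] then
   maps x to its component in [peirce e p]. *)
Definition peirce_component n (e : 'I_n -> V) (p : 'I_n * 'I_n) (x : V) : V :=
  sumv_pi (\sum_(q : 'I_n * 'I_n | (q.1 <= q.2)%N) peirce e q)%VS p x.

Definition schur n (e : 'I_n -> V) (A : 'M[R]_n) (x : V) : V :=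
  \sum_(p : 'I_n * 'I_n | (p.1 <= p.2)%N) A p.1 p.2 *: peirce_component e p x.

Lemma schur_is_linear n (e : 'I_n -> V) (A : 'M[R]_n) : linear (schur e A).
Proof.
move=> a x y; rewrite /schur scaler_sumr -big_split; apply: eq_bigr => p _ /=.
by rewrite /peirce_component linearP scalerDr !scalerA mulrC.
Qed.

HB.instance Definition _ n (e : 'I_n -> V) (A : 'M[R]_n) :=
  GRing.isLinear.Build R V V *:%R (schur e A) (schur_is_linear e A).

Lemma mem_leigenspace (f : 'End(V)) a x :
  (x \in passmx.leigenspace f a) = (f x == a *: x).
Proof.
by rewrite memv_ker add_lfunE opp_lfunE scale_lfunE id_lfunE subr_eq0.
Qed.

Lemma mem_peirce_diag n (e : 'I_n -> V) i x :
  x \in peirce e (i, i) <-> jmul J x (e i) = x.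
Proof.
rewrite /peirce eqxx mem_leigenspace lfunE scale1r jmulC.
by split=> /eqP.
Qed.

Lemma mem_peirce_off n (e : 'I_n -> V) i j x : i != j ->
  x \in peirce e (i, j) <->
  jmul J x (e i) = 2^-1 *: x /\ jmul J x (e j) = 2^-1 *: x.
Proof.
move=> /negPf ij; rewrite /peirce ij memv_cap !mem_leigenspace !lfunE.
rewrite !(jmulC J x).
by split=> [/andP[/eqP ? /eqP ?]//|[? ?]]; apply/andP; split; apply/eqP.
Qed.

End Jordan.

Definition correlation (R : realType) n (C : 'M[R]_n) : Prop :=
  [/\ C^T = C,
      forall v : 'rV[R]_n, 0 <= (v *m C *m v^T) 0 0 &
      forall i, C i i = 1].

(* Main.v *)
From HB Require Import structures.
Require Import Defs.
From mathcomp Require Import boolp classical_sets reals.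
From mathcomp Require Import all_boot all_order all_algebra.
From mathcomp Require Import ring lra.

Set Implicit Arguments.
Unset Strict Implicit.
Unset Printing Implicit Defensive.

Import Order.TTheory GRing.Theory Num.Theory.
Local Open Scope ring_scope.

(* Since [jtr] is the linear form <., e>, which does not vanish at e, every
   vector with nonzero trace, and then by translation every vector, has a
   spectral decomposition; primitive idempotents are those of trace 1.
   For a primitive idempotent p the quadratic representation
   P_a = 2 L_a^2 - L_{a^2} satisfies P_p y = <p, y> p.  When
   a = t c + (e - c) with c idempotent, this gives
   (P_a p)^2 = <p, a^2> P_a p, so P_a p is a nonnegative multiple of a
   primitive idempotent.  By composition along the frame of a, the same holds
   for every a.  As the Schur product by v^T v is P_a for a = sum_i v_i e_i, a
   positive semidefinite C, being a sum of such matrices, acts positively.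
   Doubly stochastic maps give doubly stochastic matrices <T h_j, g_i> between
   frames, whence majorization; conversely majorization controls the least
   eigenvalue and the trace.  In a simple algebra some primitive p has
   <p, e_i> > 0 for all i, and then v C v^T = <T p, P_a p> for
   a = sum_i (v_i / <p, e_i>) e_i. *)

(** * Positive semidefinite matrices and majorization *)

Section Psd.
Variables (R : rcfType) (n : nat).
Implicit Types (C : 'M[R]_n) (u v w : 'rV[R]_n).

Definition psd C : Prop := C^T = C /\ forall v, 0 <= (v *m C *m v^T) 0 0.

Lemma mx_form_delta C i j :
  ((delta_mx 0 i : 'rV_n) *m C *m (delta_mx 0 j : 'rV_n)^T) 0 0 = C i j.
Proof.
by rewrite trmx_delta -rowE -colE !mxE.
Qed.

Lemma mx_form_expand C u v t : C^T = C ->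
  ((u + t *: v) *m C *m (u + t *: v)^T) 0 0 =
  (u *m C *m u^T) 0 0 + 2 * t * (u *m C *m v^T) 0 0 + t ^+ 2 * (v *m C *m v^T) 0 0.
Proof.
move=> symC; have vu : (v *m C *m u^T) 0 0 = (u *m C *m v^T) 0 0.
  by rewrite -[v *m C *m _]trmxK mxE !trmx_mul trmxK symC mulmxA.
rewrite linearD linearZ /= !mulmxDl !mulmxDr -!scalemxAl -!scalemxAr scalerA.
by rewrite !mxE in vu *; rewrite vu; ring.
Qed.

Lemma psd_diag_ge0 C i : psd C -> 0 <= C i i.
Proof. by case=> _ /(_ (delta_mx 0 i)); rewrite mx_form_delta. Qed.

(** Along [delta_j + t delta_i] the form is affine in t with slope [2 * C j i]. Were the slope
    nonzero, the t chosen below would give the value -1. *)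
Lemma psd_diag_eq0 C i j : psd C -> C i i = 0 -> C j i = 0.
Proof.
move=> [symC pC] Cii; apply/eqP/negPn/negP => Cji.
have := pC (delta_mx 0 j + (- (C j j + 1) / (2 * C j i)) *: delta_mx 0 i).
rewrite mx_form_expand // !mx_form_delta Cii mulr0 addr0.
have -> : 2 * (- (C j j + 1) / (2 * C j i)) * C j i = - (C j j + 1) by field.
by rewrite opprD addrA subrr add0r oppr_ge0 ler10.
Qed.

(* Each step of Gaussian elimination clears one more diagonal entry. *)
Lemma psd_sum_rank1 C : psd C ->
  exists s : seq 'rV[R]_n, C = \sum_(v <- s) v^T *m v.
Proof.
have [k] := ubnP #|[pred i | C i i != 0]|; elim: k C => // k IHk C ltk pC.
have [symC posC] := pC.
have [/existsP[i Cii]|/existsPn diag0] := boolP [exists i, C i i != 0]; last first.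
  exists [::]; rewrite big_nil; apply/matrixP => i j; rewrite mxE.
  by apply: psd_diag_eq0 => //; apply/eqP/negPn/diag0.
have dpos : 0 < C i i by rewrite lt_def Cii psd_diag_ge0.
(* Scaled so that [v^T *m v] agrees with C on row and column i. *)
pose v := (Num.sqrt (C i i))^-1 *: row i C.
have vvE j l : (v^T *m v) j l = C i j * C i l / C i i.
  rewrite !mxE big_ord1 !mxE mulrACA -expr2 exprVn sqr_sqrtr ?ltW //.
  by rewrite mulrC.
have symC' : (C - v^T *m v)^T = C - v^T *m v.
  by rewrite linearB /= trmx_mul trmxK symC.
have pC' : psd (C - v^T *m v).
  split=> // u; set b := (u *m C *m (delta_mx 0 i : 'rV_n)^T) 0 0.
  (* This t minimizes the form along [u + t delta_i], and the minimum is the form of [C - v^T *m v]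
     at u. *)
  have := posC (u + (- (b / C i i)) *: delta_mx 0 i).
  rewrite mx_form_expand // mx_form_delta -/b.
  have -> : (u *m (C - v^T *m v) *m u^T) 0 0 =
      (u *m C *m u^T) 0 0 - b ^+ 2 / C i i.
    rewrite mulmxBr mulmxBl !mxE; congr (_ - _).
    have vu : (u *m v^T) 0 0 = b / Num.sqrt (C i i).
      rewrite /v linearZ /= -scalemxAr mxE mulrC /b trmx_delta; congr (_ / _).
      by rewrite tr_row symC colE mulmxA.
    have uv : (v *m u^T) 0 0 = b / Num.sqrt (C i i).
      by rewrite -vu -[v *m _]trmxK mxE trmx_mul trmxK.
    transitivity (((u *m v^T) *m (v *m u^T)) 0 0); first by rewrite !mulmxA !mxE.
    rewrite mxE big_ord1 vu uv mulrACA -expr2 -invfM -expr2 sqr_sqrtr ?ltW //.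
  move=> h; rewrite (le_trans h) // le_eqVlt; apply/orP; left; apply/eqP.
  by field.
have [|s sE] := IHk (C - v^T *m v) _ pC'.
  (* A zero diagonal entry stays zero because its column vanishes, and entry i becomes zero. *)
  rewrite -ltnS (leq_trans _ ltk) // ltnS; apply/proper_card/properP; split.
    apply/subsetP => j; rewrite !inE; apply: contraNneq => Cjj.
    rewrite 2!mxE vvE Cjj (psd_diag_eq0 i pC Cjj).
    by rewrite !mul0r subrr.
  exists i; rewrite !inE // 2!mxE vvE mulfK ?subrr ?eqxx //.
by exists (v :: s); rewrite big_cons -sE addrC subrK.
Qed.

End Psd.

Section Majorization.
Variables (R : realType) (n : nat).
Implicit Types p q : n.-tuple R.

Lemma sorted_prefix_sum p k : (k <= n)%N -> sorted >=%R p ->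
  \sum_(0 <= i < k) (sort >=%R p)`_i = \sum_(i < n | (i < k)%N) tnth p i.
Proof.
move=> kn /sorted_sort->; last exact: ge_trans.
rewrite big_mkord (big_ord_widen n (fun i => p`_i)) //.
by apply: eq_bigr => i _; rewrite (tnth_nth 0).
Qed.

Lemma sorted_tnth p (i j : 'I_n) : sorted >=%R p -> (i <= j)%N ->
  tnth p j <= tnth p i.
Proof.
move=> srt ij; rewrite !(tnth_nth 0).
by apply: (sorted_leq_nth ge_trans ge_refl) => //; rewrite inE size_tuple.
Qed.

(** The first k entries of p sum to a combination of the entries of q with weights in [0, 1] of
    total k, which is largest when the weights sit on the first k entries. *)
Lemma doubly_stochastic_majorized p q (D : 'I_n -> 'I_n -> R) :
  sorted >=%R p -> sorted >=%R q -> (forall i j, 0 <= D i j) ->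
  (forall i, \sum_j D i j = 1) -> (forall j, \sum_i D i j = 1) ->
  (forall i, tnth p i = \sum_j D i j * tnth q j) -> majorized p q.
Proof.
move=> sp sq D0 row1 col1 pE; split=> [k /andP[k1 kn]|]; last first.
  rewrite !sorted_prefix_sum //.
  under eq_bigl do rewrite ltn_ord; under [RHS]eq_bigl do rewrite ltn_ord.
  under eq_bigr do rewrite pE; rewrite exchange_big; apply: eq_bigr => j _.
  by rewrite -mulr_suml col1 mul1r.
rewrite !sorted_prefix_sum //.
pose w j := \sum_(i < n | (i < k)%N) D i j.
have w1 j : w j <= 1 by rewrite -(col1 j) /w big_mkcond ler_sum // => i _; case: ifP.
have w0 j : 0 <= w j by apply: sumr_ge0.
have lt_k : (k.-1 < n)%N by rewrite prednK.
(* Both families of weights have the same total, so subtracting the k-th entry of q changes nothing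
   and makes each summand of the difference nonnegative. *)
pose tau := tnth q (Ordinal lt_k).
have -> : \sum_(i < n | (i < k)%N) tnth p i = \sum_j w j * tnth q j.
  under eq_bigr do rewrite pE; rewrite exchange_big; apply: eq_bigr => j _.
  by rewrite -mulr_suml.
have -> : \sum_(i < n | (i < k)%N) tnth q i = \sum_(j < n) (j < k)%N%:R * tnth q j.
  by rewrite big_mkcond; apply: eq_bigr => j _; case: ifP; rewrite ?mul1r ?mul0r.
have sumw : \sum_j w j = \sum_(j < n) (j < k)%N%:R.
  rewrite exchange_big [RHS](eq_bigr (fun j : 'I_n => if (j < k)%N then 1 else 0)).
    by rewrite -big_mkcond; apply: eq_bigr.
  by move=> j _; case: ifP.
rewrite -subr_ge0 -sumrB.
have -> : \sum_(j < n) ((j < k)%N%:R * tnth q j - w j * tnth q j) =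
    \sum_(j < n) ((j < k)%N%:R - w j) * (tnth q j - tau).
  under [RHS]eq_bigr do rewrite mulrBr mulrBl.
  by rewrite [RHS]sumrB -mulr_suml [X in _ - X * _]sumrB sumw subrr mul0r subr0.
apply: sumr_ge0 => j _; case: (ltnP j k) => jk.
  rewrite mulr_ge0 ?subr_ge0 // sorted_tnth //=.
  by rewrite -ltnS prednK.
rewrite sub0r mulNr -mulrN opprB mulr_ge0 ?subr_ge0 // sorted_tnth //=.
by rewrite (leq_trans (leq_pred _)).
Qed.

Lemma majorized_sum p q : majorized p q -> \sum_i tnth p i = \sum_i tnth q i.
Proof.
have h (r : n.-tuple R) : \sum_i tnth r i = \sum_(0 <= i < n) (sort >=%R r)`_i.
  rewrite -(big_tuple _ _ r xpredT id) (perm_big (sort >=%R r)) /=; last first.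
    by rewrite perm_sym perm_sort.
  by rewrite (big_nth 0) size_sort size_tuple.
by case=> _; rewrite !h.
Qed.

(** The least entry is the total minus the sum of the n - 1 others, which majorization bounds. *)
Lemma majorized_lower_bound p q m : sorted >=%R p -> sorted >=%R q ->
  majorized p q -> (forall i, m <= tnth q i) -> forall i, m <= tnth p i.
Proof.
move=> sp sq [le_pq eq_pq] mq i.
have n0 : (0 < n)%N := leq_ltn_trans (leq0n i) (ltn_ord i).
have last_n : (n.-1 < n)%N by rewrite prednK.
pose l := Ordinal last_n.
have le_il : (i <= l)%N by rewrite /= -ltnS prednK.
apply: le_trans (sorted_tnth sp le_il); apply: le_trans (mq l) _.
have split_last (r : n.-tuple R) : sorted >=%R r -> \sum_(0 <= i < n) (sort >=%R r)`_i =
   \sum_(0 <= i < n.-1) (sort >=%R r)`_i + tnth r l.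
  move=> sr; rewrite -{1}(prednK n0) big_nat_recr //=.
  rewrite sorted_sort //; last exact: ge_trans.
  by rewrite (tnth_nth 0).
have : \sum_(0 <= i < n.-1) (sort >=%R p)`_i <= \sum_(0 <= i < n.-1) (sort >=%R q)`_i.
  (* For n = 1 the prefix is empty, outside the range [1 <= k]. *)
  have [->|np] := posnP n.-1; first by rewrite !big_geq.
  by apply: le_pq; rewrite np leq_pred.
by move: eq_pq; rewrite !split_last //; lra.
Qed.

End Majorization.

(** * Jordan identity and quadratic representation *)

Section JordanAlgebra.
Variables (R : realType) (V : vectType R) (J : euclidean_jordan V).
Implicit Types (x y z u w c d p : V) (t : R).

Local Notation "x ** y" := (jmul J x y) (at level 40, left associativity).
Local Notation "<| x , y |>" := (jdot J x y) (at level 0).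
Local Notation ee := (jone J).

Let mulDl x y z : (x + y) ** z = x ** z + y ** z. Proof. exact: linearDl. Qed.
Let mulDr x y z : x ** (y + z) = x ** y + x ** z. Proof. exact: linearDr. Qed.
Let mulNl x y : (- x) ** y = - (x ** y). Proof. exact: linearNl. Qed.
Let mulNr x y : x ** (- y) = - (x ** y). Proof. exact: linearNr. Qed.
Let mulZl t x y : (t *: x) ** y = t *: (x ** y). Proof. exact: linearZl_LR. Qed.
Let mulZr t x y : x ** (t *: y) = t *: (x ** y). Proof. exact: linearZr_LR. Qed.
Let jmul0l x : 0 ** x = 0. Proof. exact: linear0l. Qed.
Let jmul0r x : x ** 0 = 0. Proof. exact: linear0r. Qed.
Let muljE := (mulDl, mulDr, mulNl, mulNr, mulZl, mulZr, jmul0l, jmul0r).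
Let jC := jmulC J.

Let dotDl x y z : <|x + y, z|> = <|x, z|> + <|y, z|>. Proof. exact: linearDl. Qed.
Let dotDr x y z : <|x, y + z|> = <|x, y|> + <|x, z|>. Proof. exact: linearDr. Qed.
Let dotNl x y : <|- x, y|> = - <|x, y|>. Proof. exact: linearNl. Qed.
Let dotNr x y : <|x, - y|> = - <|x, y|>. Proof. exact: linearNr. Qed.
Let dotZl t x y : <|t *: x, y|> = t * <|x, y|>. Proof. exact: linearZl_LR. Qed.
Let dotZr t x y : <|x, t *: y|> = t * <|x, y|>. Proof. exact: linearZr_LR. Qed.
Let dot0l x : <|0, x|> = 0. Proof. exact: linear0l. Qed.
Let dot0r x : <|x, 0|> = 0. Proof. exact: linear0r. Qed.
Let dotjE := (dotDl, dotDr, dotNl, dotNr, dotZl, dotZr, dot0l, dot0r).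

Lemma jdotC x y : <|x, y|> = <|y, x|>.
Proof. by rewrite hermC expr0 mul1r. Qed.

Lemma jdot_mulr x y z : <|x, y ** z|> = <|y ** x, z|>.
Proof. by rewrite jdot_assoc. Qed.

Lemma jdot_gt0 x : x != 0 -> 0 < <|x, x|>.
Proof. exact: neq0_dnorm_gt0. Qed.

Lemma jdot_ge0 x : 0 <= <|x, x|>.
Proof. by have [->|/jdot_gt0/ltW//] := eqVneq x 0; rewrite dot0l. Qed.

Lemma jdot_eq0 x : <|x, x|> = 0 -> x = 0.
Proof. by move=> h; apply/eqP/negPn/negP => /jdot_gt0; rewrite h ltxx. Qed.

Lemma jdot_inj x y : (forall z, <|x, z|> = <|y, z|>) -> x = y.
Proof.
move=> h; apply/eqP; rewrite -subr_eq0; apply/eqP/jdot_eq0.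
by rewrite dotDl dotNl h subrr.
Qed.

(** Pairing with an arbitrary [z] turns linear identities between vectors into scalar ones, within
    reach of [lra], [ring] and [field]; hypotheses are paired by [congr1]. *)
Ltac dotted z := apply: jdot_inj => z; rewrite ?dotjE.

(* The part of the Jordan identity that is linear in [z], extracted from its
   instances at [x + z], [x - z] and [z]. *)
Lemma jordan_linearized1 x y z :
  z ** ((x ** x) ** y) + 2 *: (x ** ((x ** z) ** y)) =
  (x ** x) ** (z ** y) + 2 *: ((x ** z) ** (x ** y)).
Proof.
have hp := jmul_jordan J (x + z) y; have hm := jmul_jordan J (x - z) y.
have hz := jmul_jordan J z y.
dotted u; move: (congr1 (jdot J ^~ u) hp) (congr1 (jdot J ^~ u) hm).
move: (congr1 (jdot J ^~ u) hz).
by rewrite /= !muljE !dotjE (jC z x); lra.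
Qed.

(** Second polarization: the part of [jordan_linearized1] at [x + y] that is bilinear in x and y. *)
Lemma jordan_linearized x y z w :
  x ** ((y ** z) ** w) + y ** ((z ** x) ** w) + z ** ((x ** y) ** w) =
  (y ** z) ** (x ** w) + (z ** x) ** (y ** w) + (x ** y) ** (z ** w).
Proof.
have h1 := jordan_linearized1 (x + y) w z.
have h2 := jordan_linearized1 x w z; have h3 := jordan_linearized1 y w z.
dotted u; move: (congr1 (jdot J ^~ u) h1) (congr1 (jdot J ^~ u) h2).
move: (congr1 (jdot J ^~ u) h3).
by rewrite /= !muljE !dotjE (jC y x) (jC z x); lra.
Qed.

Definition quad a x := 2 *: (a ** (a ** x)) - (a ** a) ** x.

Lemma quad_linear a : linear (quad a).
Proof. by move=> t x y; dotted z; rewrite /quad !muljE !dotjE; lra. Qed.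

HB.instance Definition _ a :=
  GRing.isLinear.Build R V V *:%R (quad a) (quad_linear a).

Lemma jdot_quad a x y : <|quad a x, y|> = <|x, quad a y|>.
Proof. by rewrite /quad !dotjE !jdot_mulr. Qed.

Lemma jmulr1 x : x ** ee = x. Proof. by rewrite jC jmul1. Qed.

Lemma quad1r a : quad a ee = a ** a.
Proof. by rewrite /quad !jmulr1 scaler_nat mulr2n addrK. Qed.

(** * Peirce decomposition relative to an idempotent *)

Section Idempotent.
Variables (c : V) (cc : c ** c = c).

(** As a polynomial in multiplication by c this is [s (s - 1) (2 s - 1) = 0], so the only possible
    eigenvalues are 0, 1/2 and 1. *)
Lemma peirce_polynomial x :
  2 *: (c ** (c ** (c ** x))) = 3 *: (c ** (c ** x)) - c ** x.
Proof.
have h := jordan_linearized x c c c; dotted u.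
move: (congr1 (jdot J ^~ u) h); by rewrite /= !cc !(jC _ c) !dotjE; lra.
Qed.

Lemma peirce_decomposition x : exists x1 xh x0,
  [/\ x = x1 + xh + x0, c ** x1 = x1, c ** xh = 2^-1 *: xh & c ** x0 = 0].
Proof.
have h := peirce_polynomial x.
(* The Lagrange interpolation polynomials at 1, 1/2 and 0. *)
exists (2 *: (c ** (c ** x)) - c ** x), (4 *: (c ** x) - 4 *: (c ** (c ** x))),
  (x - 3 *: (c ** x) + 2 *: (c ** (c ** x))).
by split; dotted u; move: (congr1 (jdot J ^~ u) h); rewrite /= ?muljE !dotjE; lra.
Qed.

Lemma peirce_commute1 y w : c ** y = y -> c ** (y ** w) = y ** (c ** w).
Proof.
move=> cy; have h := jordan_linearized1 c w y; dotted u.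
by move: (congr1 (jdot J ^~ u) h); rewrite /= !cc !cy !dotjE; lra.
Qed.

Lemma peirce_commute0 y w : c ** y = 0 -> c ** (y ** w) = y ** (c ** w).
Proof.
move=> cy; have := jordan_linearized1 c w y.
by rewrite /= !cc !cy !jmul0l jmul0r scaler0 !addr0 => ->.
Qed.

(** The product is fixed by c, as multiplication by z commutes with c, and killed by c, as
    multiplication by y does too. *)
Lemma peirce_orthogonal y z : c ** y = y -> c ** z = 0 -> y ** z = 0.
Proof.
move=> cy cz; have := peirce_commute0 y cz; rewrite cy => h.
by rewrite jC -h (jC z y) (peirce_commute1 _ cy) cz jmul0r.
Qed.

(** In other words, the product has no component in the 1/2-space of c. *)
Lemma peirce_half_square x y : c ** x = 2^-1 *: x -> c ** y = 2^-1 *: y ->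
  c ** (c ** (x ** y)) = c ** (x ** y).
Proof.
move=> cx cy; have h := jordan_linearized c x y c; dotted u.
move: (congr1 (jdot J ^~ u) h); rewrite /= cc (jC y c) (jC x c) cx cy.
rewrite !muljE (jC x c) (jC y c) cx cy !muljE (jC (x ** y)) (jC y x) !dotjE.
by lra.
Qed.

(* On the spectrum {0, 1/2, 1} of multiplication by [c],
   s = s^2 + 4 (s - s^2)^2. *)
Lemma jdot_idempotent_mul x :
  <|c ** x, x|> = <|c ** x, c ** x|> +
     4 * <|c ** x - c ** (c ** x), c ** x - c ** (c ** x)|>.
Proof.
have h := peirce_polynomial x.
move: (congr1 (jdot J ^~ x) h) (congr1 (jdot J ^~ (c ** x)) h).
by rewrite /= !dotjE !jdot_assoc; lra.
Qed.

Lemma jdot_idempotent_mul_ge0 x : 0 <= <|c ** x, x|>.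
Proof.
by rewrite jdot_idempotent_mul addr_ge0 ?mulr_ge0 ?jdot_ge0.
Qed.

Lemma jdot_idempotent_mul_eq0 x : <|c ** x, x|> = 0 -> c ** x = 0.
Proof.
rewrite jdot_idempotent_mul => h; apply: jdot_eq0.
have h1 := jdot_ge0 (c ** x).
have h2 := jdot_ge0 (c ** x - c ** (c ** x)).
by lra.
Qed.

End Idempotent.

Lemma jdot_idempotent_ge0 c d : c ** c = c -> d ** d = d -> 0 <= <|c, d|>.
Proof.
by move=> cc dd; rewrite -{1}dd jdot_mulr jC jdot_idempotent_mul_ge0.
Qed.

Lemma jdot_idempotent_eq0 c d : c ** c = c -> d ** d = d -> <|c, d|> = 0 ->
  c ** d = 0.
Proof.
by move=> cc dd; rewrite -{1}dd jdot_mulr (jC d); exact: jdot_idempotent_mul_eq0.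
Qed.

Lemma jdot_trace x y : <|x, y|> = <|x ** y, ee|>.
Proof. by rewrite jdot_assoc jmulr1 jdotC. Qed.

Lemma jdot_suml I (r : seq I) (P : pred I) (F : I -> V) x :
  <|\sum_(i <- r | P i) F i, x|> = \sum_(i <- r | P i) <|F i, x|>.
Proof. exact: linear_sumlz. Qed.

Lemma jdot_sumr I (r : seq I) (P : pred I) (F : I -> V) x :
  <|x, \sum_(i <- r | P i) F i|> = \sum_(i <- r | P i) <|x, F i|>.
Proof. exact: linear_sumr. Qed.

Lemma jmul_suml I (r : seq I) (P : pred I) (F : I -> V) x :
  (\sum_(i <- r | P i) F i) ** x = \sum_(i <- r | P i) (F i ** x).
Proof. exact: linear_sumlz. Qed.

Lemma jmul_sumr I (r : seq I) (P : pred I) (F : I -> V) x :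
  x ** (\sum_(i <- r | P i) F i) = \sum_(i <- r | P i) (x ** F i).
Proof. exact: linear_sumr. Qed.

(** * Peirce decomposition relative to a Jordan frame *)

Section Frame.
Variables (m : nat) (g : 'I_m -> V) (fg : jordan_frame J g).

Lemma frame_idempotent i : g i ** g i = g i.
Proof. by case: fg => /(_ i)[]. Qed.

Lemma frame_neq0 i : g i <> 0.
Proof. by case: fg => /(_ i)[]. Qed.

Lemma frame_orthogonal i j : i != j -> g i ** g j = 0.
Proof. by case: fg => _ + _; exact. Qed.

Lemma frame_sum : \sum_i g i = ee.
Proof. by case: fg. Qed.

Lemma jdot_frame i j : i != j -> <|g i, g j|> = 0.
Proof. by move=> ij; rewrite jdot_trace frame_orthogonal // dot0l. Qed.

Lemma jdot_frame_gt0 i : 0 < <|g i, g i|>.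
Proof. by apply: jdot_gt0; apply/eqP/frame_neq0. Qed.

Lemma frame_mul_sum (s : 'I_m -> R) j : g j ** (\sum_i s i *: g i) = s j *: g j.
Proof.
rewrite jmul_sumr (bigD1 j) //= big1 ?addr0 ?mulZr ?frame_idempotent // => i ij.
by rewrite mulZr frame_orthogonal ?scaler0 // eq_sym.
Qed.

Lemma frame_sum_mul (s t : 'I_m -> R) :
  (\sum_i s i *: g i) ** (\sum_i t i *: g i) = \sum_i (s i * t i) *: g i.
Proof.
by rewrite jmul_suml; apply: eq_bigr => i _; rewrite mulZl frame_mul_sum scalerA.
Qed.

Lemma jdot_frame_sum (s : 'I_m -> R) j :
  <|\sum_i s i *: g i, g j|> = s j * <|g j, g j|>.
Proof.
by rewrite jdotC -[in LHS](frame_idempotent j) jdot_assoc frame_mul_sum dotZr.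
Qed.

Lemma jdot_sum_frame x : \sum_i <|x, g i|> = <|x, ee|>.
Proof. by rewrite -frame_sum jdot_sumr. Qed.

Lemma idempotent_coordinate (s : 'I_m -> R) x : x = \sum_i s i *: g i ->
  x ** x = x -> forall i, s i = 0 \/ s i = 1.
Proof.
move=> xE xx i; have := congr1 (jdot J ^~ (g i)) xx.
rewrite /= {1 2 3}xE frame_sum_mul !jdot_frame_sum.
move/(mulIf (lt0r_neq0 (jdot_frame_gt0 i)))/eqP.
rewrite -subr_eq0 -{3}[s i]mulr1 -mulrBr mulf_eq0 subr_eq0.
by case/orP => /eqP ->; [left | right].
Qed.

(* For [i = j] the weight is 1 at [k = i], so that diagonal and off-diagonal
   Peirce spaces are treated uniformly. *)
Definition peirce_block i j x : Prop :=
  forall k, g k ** x = (((k == i)%:R + (k == j)%:R) / 2) *: x.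

(* The sum of these over all ordered pairs is [x]: for [i != j], the (i, j) and
   (j, i) terms are equal, and each is half of the Peirce component. *)
Definition block_component i j x :=
  2 *: (g i ** (g j ** x)) - (i == j)%:R *: (g i ** x).

Lemma frame_commute i j x : g i ** (g j ** x) = g j ** (g i ** x).
Proof.
have [->//|ij] := eqVneq i j.
exact/(peirce_commute0 (frame_idempotent i))/frame_orthogonal.
Qed.

(** For the remaining k, [g k] lies in the 0-space and x in the 1-space of the idempotent [g i] or
    [g i + g j], so their product vanishes. *)
Lemma peirce_blockP i j x : g i ** x = ((1 + (i == j)%:R) / 2) *: x ->
  g j ** x = ((1 + (i == j)%:R) / 2) *: x -> peirce_block i j x.
Proof.
move=> gix gjx k.
have [->|ki] := eqVneq k i; first by rewrite gix.
have [kj|kj] := eqVneq k j.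
  by rewrite kj gjx -kj eq_sym (negPf ki) addrC.
rewrite addr0 mul0r scale0r jC.
have [ijE|ij] := eqVneq i j.
  apply: (peirce_orthogonal (frame_idempotent i)); last first.
    by rewrite frame_orthogonal 1?eq_sym.
  by rewrite gix ijE eqxx (_ : _ / _ = 1) ?scale1r //=; lra.
have ji : j != i by rewrite eq_sym.
apply: (@peirce_orthogonal (g i + g j)).
- by rewrite !muljE !frame_idempotent !frame_orthogonal // addr0 add0r.
- rewrite mulDl gix gjx (negPf ij) addr0 -scalerDl.
  by rewrite (_ : _ + _ = 1) ?scale1r //=; lra.
- by rewrite mulDl !frame_orthogonal 1?eq_sym // addr0.
Qed.

Lemma block_component_block i j x : peirce_block i j (block_component i j x).
Proof.
rewrite /block_component; have [->|ij] := eqVneq i j.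
  suff h : g j ** (2 *: (g j ** (g j ** x)) - 1 *: (g j ** x)) =
      ((1 + (j == j)%:R) / 2) *: (2 *: (g j ** (g j ** x)) - 1 *: (g j ** x)).
    exact: peirce_blockP.
  rewrite eqxx; have h := peirce_polynomial (frame_idempotent j) x.
  by dotted u; move: (congr1 (jdot J ^~ u) h); rewrite /= !muljE !dotjE; lra.
(* The Peirce 1-component of x for [g k] is annihilated by [g l], so [g k] acts as 1/2 on
   [g k ** (g l ** x)]. *)
have half k l : k != l -> 2 *: (g k ** (g k ** (g l ** x))) = g k ** (g l ** x).
  move=> kl; have h := peirce_polynomial (frame_idempotent k) x.
  have : (2 *: (g k ** (g k ** x)) - g k ** x) ** g l = 0.
    apply: (peirce_orthogonal (frame_idempotent k)); last exact: frame_orthogonal.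
    by dotted u; move: (congr1 (jdot J ^~ u) h); rewrite /= !muljE !dotjE; lra.
  rewrite jC !muljE => /eqP; rewrite subr_eq0 => /eqP.
  by rewrite !(frame_commute l k).
rewrite scale0r subr0; apply: peirce_blockP; rewrite (negPf ij) addr0 mulZr.
  by rewrite half // scalerA divfK ?scale1r ?pnatr_eq0.
by rewrite (frame_commute i j) half 1?eq_sym // scalerA divfK ?scale1r ?pnatr_eq0.
Qed.

Lemma block_component_sum x : \sum_i \sum_j block_component i j x = x.
Proof.
transitivity (\sum_i (2 *: (g i ** x) - g i ** x)).
  apply: eq_bigr => i _; rewrite /block_component sumrB; congr (_ - _).
    by rewrite -scaler_sumr -jmul_sumr -jmul_suml frame_sum jmul1.
  rewrite (bigD1 i) //= eqxx scale1r big1 ?addr0 // => j ij.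
  by rewrite eq_sym (negPf ij) scale0r.
rewrite sumrB -scaler_sumr -jmul_suml frame_sum jmul1.
by rewrite scaler_nat mulr2n addrK.
Qed.

Lemma sum_half_delta (f : 'I_m -> R) i j :
  \sum_k f k * (((k == i)%:R + (k == j)%:R) / 2) = (f i + f j) / 2.
Proof.
under eq_bigr do rewrite mulrA mulrDr.
rewrite -mulr_suml big_split /=; congr ((_ + _) / 2).
  by rewrite (bigD1 i) //= eqxx mulr1 big1 ?addr0 // => k /negPf->; rewrite mulr0.
by rewrite (bigD1 j) //= eqxx mulr1 big1 ?addr0 // => k /negPf->; rewrite mulr0.
Qed.

Lemma block_mul (s : 'I_m -> R) i j x : peirce_block i j x ->
  (\sum_k s k *: g k) ** x = ((s i + s j) / 2) *: x.
Proof.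
move=> bx; rewrite jmul_suml.
transitivity (\sum_k (s k * (((k == i)%:R + (k == j)%:R) / 2)) *: x).
  by apply: eq_bigr => k _; rewrite mulZl bx scalerA.
by rewrite -scaler_suml sum_half_delta.
Qed.

(** The scalar is [2 ((s i + s j) / 2)^2 - (s i^2 + s j^2) / 2]. *)
Lemma quad_block (s : 'I_m -> R) i j x : peirce_block i j x ->
  quad (\sum_k s k *: g k) x = (s i * s j) *: x.
Proof.
move=> bx; rewrite /quad frame_sum_mul !(block_mul _ bx) mulZr (block_mul _ bx).
by rewrite !scalerA -scalerBl; congr (_ *: _); field.
Qed.

Lemma quad_frame (s : 'I_m -> R) x :
  quad (\sum_k s k *: g k) x = \sum_i \sum_j (s i * s j) *: block_component i j x.
Proof.
rewrite -{1}(block_component_sum x) linear_sum; apply: eq_bigr => i _.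
rewrite linear_sum; apply: eq_bigr => j _.
exact/quad_block/block_component_block.
Qed.

Lemma quad_frame_comp (s t : 'I_m -> R) x :
  quad (\sum_k s k *: g k) (quad (\sum_k t k *: g k) x) =
  quad (\sum_k (s k * t k) *: g k) x.
Proof.
rewrite (quad_frame t) (quad_frame (fun k => s k * t k)) linear_sum.
apply: eq_bigr => i _.
rewrite linear_sum; apply: eq_bigr => j _.
rewrite linearZ /= (quad_block _ (block_component_block i j x)) scalerA.
by congr (_ *: _); ring.
Qed.

Lemma peirceP i j x : x \in peirce J g (i, j) <-> peirce_block i j x.
Proof.
have [<-|ij] := eqVneq i j.
  rewrite mem_peirce_diag jC; split=> [gx|/(_ i)]; last first.
    by rewrite eqxx => ->; rewrite (_ : _ / _ = 1) ?scale1r //=; lra.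
  have h : g i ** x = ((1 + (i == i)%:R) / 2) *: x.
    by rewrite eqxx (_ : _ / _ = 1) ?scale1r //=; lra.
  exact: peirce_blockP.
rewrite mem_peirce_off // !(jC x); split=> [[gi gj]|bx].
  by have := @peirce_blockP i j x; rewrite (negPf ij) addr0 div1r; apply.
by rewrite !bx !eqxx (eq_sym j) (negPf ij) addr0 add0r div1r.
Qed.

Lemma block_component_linear i j : linear (block_component i j).
Proof.
by move=> t x y; dotted z; rewrite /block_component !muljE !dotjE; ring.
Qed.

HB.instance Definition _ i j :=
  GRing.isLinear.Build R V V *:%R (block_component i j) (block_component_linear i j).

(** On the block (i, j) each [block_component k l] is a scalar: 1/2 at (i, j) and at (j, i), or 1 at
    (i, i) when i = j, and 0 elsewhere. *)
Lemma sum_block_component (A : 'M[R]_m) i j x : A^T = A -> peirce_block i j x ->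
  \sum_k \sum_l A k l *: block_component k l x = A i j *: x.
Proof.
move=> symA bx; pose d k : R := ((k == i)%:R + (k == j)%:R) / 2.
have compE k l : block_component k l x = (2 * d k * d l - (k == l)%:R * d k) *: x.
  by rewrite /block_component !bx !mulZr !bx; dotted z; rewrite -/(d k) -/(d l); ring.
have Aji : A j i = A i j by rewrite -[in LHS]symA mxE.
transitivity (\sum_k ((A k i + A k j) * d k - A k k * d k) *: x).
  apply: eq_bigr => k _.
  transitivity ((\sum_l (A k l * d l * (2 * d k) - A k l * (k == l)%:R * d k)) *: x).
    rewrite scaler_suml; apply: eq_bigr => l _; rewrite compE scalerA.
    by congr (_ *: _); ring.
  rewrite sumrB -mulr_suml sum_half_delta -mulr_suml; congr ((_ - _ * _) *: x).
    by field.
  rewrite (bigD1 k) //= eqxx mulr1 big1 ?addr0 // => l kl.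
  by rewrite eq_sym (negPf kl) mulr0.
rewrite -scaler_suml sumrB !sum_half_delta; congr (_ *: x).
by rewrite Aji; field.
Qed.

(** Summing over all ordered pairs gives the same shape as [quad_frame], so a decomposition of A
    into rank-one matrices carries over to the Schur product. *)
Lemma schurE (A : 'M[R]_m) x : A^T = A ->
  schur J g A x = \sum_i \sum_j A i j *: block_component i j x.
Proof.
move=> symA.
pose W := (\sum_(q : 'I_m * 'I_m | (q.1 <= q.2)%N) peirce J g q)%VS.
have xW : x \in W.
  rewrite -(block_component_sum x); apply: memv_suml => i _; apply: memv_suml => j _.
  have bx := block_component_block i j x.
  have [ij|/ltnW ji] := leqP i j.
    by apply: (subvP (@sumv_sup _ _ _ (i, j) _ _ _ ij (subvv _))); apply/peirceP.
  apply: (subvP (@sumv_sup _ _ _ (j, i) _ _ _ ji (subvv _))); apply/peirceP => k.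
  by rewrite bx addrC.
have xE : x = \sum_(q : 'I_m * 'I_m | (q.1 <= q.2)%N) peirce_component J g q x.
  by rewrite {1}[x](esym (sumv_pi_sum (erefl W) xW)).
have -> : \sum_i \sum_j A i j *: block_component i j x =
  \sum_(q : 'I_m * 'I_m | (q.1 <= q.2)%N)
    \sum_i \sum_j A i j *: block_component i j (peirce_component J g q x).
  rewrite [RHS]exchange_big; apply: eq_bigr => i _; rewrite [RHS]exchange_big.
  by apply: eq_bigr => j _; rewrite {1}xE linear_sum scaler_sumr.
apply: eq_bigr => -[i j] _; rewrite (@sum_block_component _ i j) //.
by apply/peirceP; exact: memv_sum_pi.
Qed.

Lemma jdot_block_component i j x k :
  <|block_component i j x, g k|> = ((i == k) && (j == k))%:R * <|x, g k|>.
Proof.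
rewrite /block_component !dotjE !jdot_assoc.
have [->|ik] := eqVneq i k; last first.
  by rewrite frame_orthogonal // jmul0r !dot0r !mulr0 subr0 mul0r.
rewrite frame_idempotent (eq_sym k); have [->|jk] := eqVneq j k.
  by rewrite frame_idempotent /=; ring.
by rewrite frame_orthogonal //= dot0r; ring.
Qed.

Lemma jdot_schur (A : 'M[R]_m) x k : A^T = A ->
  <|schur J g A x, g k|> = A k k * <|x, g k|>.
Proof.
move=> /schurE ->; rewrite jdot_suml (bigD1 k) //= jdot_suml (bigD1 k) //=.
rewrite dotZl jdot_block_component eqxx mul1r !big1 ?addr0 //.
  move=> i /negPf ik; rewrite jdot_suml big1 // => j _.
  by rewrite dotZl jdot_block_component ik mul0r mulr0.
by move=> j /negPf jk; rewrite dotZl jdot_block_component jk andbF mul0r mulr0.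
Qed.

Lemma schur_unit (A : 'M[R]_m) : A^T = A -> (forall i, A i i = 1) ->
  schur J g A ee = ee.
Proof.
move=> /schurE -> diagA; rewrite -[RHS]frame_sum; apply: eq_bigr => i _.
rewrite (bigD1 i) //= diagA big1 => [|j ji]; last first.
  by rewrite /block_component !jmulr1 eq_sym (negPf ji) frame_orthogonal 1?eq_sym //
    scale0r subr0 !scaler0.
by rewrite /block_component !jmulr1 frame_idempotent eqxx; dotted z; rewrite /=; ring.
Qed.

Lemma schur_rank1 (v : 'rV[R]_m) x :
  \sum_i \sum_j (v^T *m v) i j *: block_component i j x =
  quad (\sum_k v 0 k *: g k) x.
Proof.
rewrite quad_frame; apply: eq_bigr => i _; apply: eq_bigr => j _.
by rewrite !mxE big_ord1 !mxE.
Qed.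

End Frame.

(** * Spectral decomposition and primitive idempotents *)

Section Trace.
Hypothesis trace_dot : forall x y, <|x, y|> = jtr J (x ** y).
Variables (e0 : 'I_(jrank J) -> V) (frame_e0 : jordan_frame J e0).

Lemma jtrE x : jtr J x = <|x, ee|>.
Proof. by rewrite trace_dot jmulr1. Qed.

(* A vector without decomposition would have trace 0 by convention, while
   [jtr] is linear and nonzero at the unit: translate by the unit if needed. *)
Lemma spectral x : sorted >=%R (eigenvalues J x) /\
  exists2 g, jordan_frame J g & x = \sum_i tnth (eigenvalues J x) i *: g i.
Proof.
pose P y := [set s : (jrank J).-tuple R | sorted >=%R s /\
  exists2 g, jordan_frame J g & y = \sum_i tnth s i *: g i]%classic.
suff ex y : exists s, P y s by exact: (xgetPex [tuple 0 | _ < jrank J] (ex x)).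
have tr_neq0 z : jtr J z != 0 -> exists s, P z s.
  apply: contra_neqP => /forallNP nP; rewrite /jtr /eigenvalues xgetPN //.
  by rewrite big1 // => i _; rewrite tnth_mktuple.
have [one0|one_neq0] := eqVneq ee 0.
  exists [tuple of nseq (jrank J) 0]; split.
    by apply/(sortedP 0) => i _; rewrite /= !nth_nseq; do 2 case: ifP.
  exists e0 => //; rewrite big1 => [|i _]; last by rewrite tnth_nseq scale0r.
  by rewrite -[y](jmul1 J) one0 jmul0l.
have [try|/tr_neq0//] := eqVneq (jtr J y) 0.
have /tr_neq0[s [srt [g fg yE]]] : jtr J (y + ee) != 0.
  by rewrite jtrE dotDl -jtrE try add0r gt_eqF ?jdot_gt0.
exists [tuple of map (fun t => t - 1) s]; split; last first.
  exists g => //; rewrite -[LHS](addrK ee) yE -(frame_sum fg) -sumrB.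
  by apply: eq_bigr => i _; rewrite tnth_map scalerBl scale1r.
by rewrite /= sorted_map; apply: sub_sorted srt => t u; rewrite /= lerD2r.
Qed.

(** The eigenvalues are 0 or 1. If [g j] has eigenvalue 1, then [c - g j] is idempotent and
    primitivity forces [c = g j]. *)
Lemma primitive_trace c : primitive J c -> <|c, ee|> = 1.
Proof.
case=> cc c0 cprim; rewrite -jtrE /jtr.
have [_ [g fg]] := spectral c.
move: (tnth (eigenvalues J c)) => s cE.
have s01 := idempotent_coordinate fg cE cc.
have [/existsP[j /eqP sj]|/existsPn s_neq1] :=
    boolP [exists j, s j == 1]; last first.
  case: c0; rewrite cE big1 // => i _.
  by case: (s01 i) (s_neq1 i) => ->; rewrite ?eqxx // scale0r.
have gc : g j ** c = g j by rewrite cE frame_mul_sum // sj scale1r.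
have cgj : c = g j.
  have [] // := cprim (g j) (c - g j); first exact: frame_idempotent.
  - by rewrite /Defs.idempotent !muljE cc (jC c) gc frame_idempotent //; dotted z; lra.
  - by rewrite addrC subrK.
  - by move=> gj0; case: (frame_neq0 fg gj0).
  - by move/eqP; rewrite subr_eq0 => /eqP.
rewrite (bigD1 j) //= sj big1 ?addr0 // => i ij.
have := jdot_frame_sum fg s i.
rewrite -cE cgj (jdot_frame fg) 1?eq_sym // => /esym/eqP.
by rewrite mulf_eq0 (gt_eqF (jdot_frame_gt0 fg i)) orbF => /eqP.
Qed.

Lemma frame_trace m (g : 'I_m -> V) i : jordan_frame J g -> <|g i, ee|> = 1.
Proof. by case=> /(_ i) /primitive_trace. Qed.

Lemma frame_norm m (g : 'I_m -> V) i : jordan_frame J g -> <|g i, g i|> = 1.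
Proof. by move=> fg; rewrite jdot_trace (frame_idempotent fg) (frame_trace _ fg). Qed.

Lemma idempotent_trace_ge1 c : c ** c = c -> c != 0 -> 1 <= <|c, ee|>.
Proof.
move=> cc c0; have [_ [g fg cE]] := spectral c.
have s01 := idempotent_coordinate fg cE cc.
have [/existsP[j /eqP sj]|/existsPn s_neq1] :=
    boolP [exists j, tnth (eigenvalues J c) j == 1]; last first.
  case/eqP: c0; rewrite cE big1 // => i _.
  by case: (s01 i) (s_neq1 i) => ->; rewrite ?eqxx // scale0r.
rewrite -(jdot_sum_frame fg) cE (bigD1 j) //= jdot_frame_sum // sj mul1r.
rewrite frame_norm // lerDl sumr_ge0 // => i _.
by rewrite jdot_frame_sum // frame_norm // mulr1; case: (s01 i) => ->.
Qed.

(** A splitting into two nonzero idempotents would have trace at least 2. *)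
Lemma primitive_of_trace c : c ** c = c -> <|c, ee|> = 1 -> primitive J c.
Proof.
move=> cc trc; split=> // [c0|a b aa bb cE].
  by move/eqP: trc; rewrite c0 dot0l eq_sym oner_eq0.
have [->|a0] := eqVneq a 0; [by left | right; apply/eqP/negPn/negP => b0].
move: (idempotent_trace_ge1 aa a0) (idempotent_trace_ge1 bb b0).
by move: trc; rewrite cE dotDl; lra.
Qed.

(** Testing against idempotents frees nonnegativity from the chosen decomposition and makes it
    stable under sums. *)
Lemma jnnegP x : jnneg J x <-> forall c, c ** c = c -> 0 <= <|x, c|>.
Proof.
have [_ [g fg xE]] := spectral x; split=> [x0 c cc|x0 i].
  rewrite xE jdot_suml sumr_ge0 // => i _.
  by rewrite dotZl mulr_ge0 ?jdot_idempotent_ge0 // (frame_idempotent fg).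
have := x0 _ (frame_idempotent fg i).
by rewrite [in X in X -> _]xE jdot_frame_sum // frame_norm // mulr1.
Qed.

(* If y = sum_i s_i g_i then <y ** y, ee - x> = 0 reads
   sum_i s_i^2 (1 - <x, g_i>) = 0, and <x, g_i> = 1 forces x = g_i. *)
Lemma primitive_eigenspace x y : primitive J x -> x ** y = y -> exists t, y = t *: x.
Proof.
move=> px xy; have [xx _ _] := px; have trx := primitive_trace px.
have [_ [g fg]] := spectral y; move: (tnth (eigenvalues J y)) => s yE.
have xg_ge0 i : 0 <= <|x, g i|>.
  by rewrite jdot_idempotent_ge0 // (frame_idempotent fg).
have xg_le1 i : <|x, g i|> <= 1.
  by rewrite -trx -(jdot_sum_frame fg) (bigD1 i) //= lerDl sumr_ge0.
have sum0 : \sum_i s i ^+ 2 * (1 - <|x, g i|>) = 0.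
  have: <|y ** y, ee|> = <|x, y ** y|> by rewrite jdot_mulr (jC y) xy -jdot_trace.
  rewrite yE (frame_sum_mul fg) jdot_suml jdot_sumr => /eqP.
  rewrite -subr_eq0 -sumrB => /eqP h; rewrite -[RHS]h; apply: eq_bigr => i _.
  by rewrite dotZl dotZr (frame_trace _ fg) expr2 mulr1 mulrBr mulr1.
have [/existsP[i si]|/existsPn s0] := boolP [exists i, s i != 0]; last first.
  by exists 0; rewrite scale0r yE big1 // => i _; rewrite (eqP (negPn (s0 i))) scale0r.
have xg1 : <|x, g i|> = 1.
  move/eqP: sum0; rewrite psumr_eq0 => [/allP/(_ i)|j _]; last first.
    by rewrite mulr_ge0 ?sqr_ge0 ?subr_ge0.
  rewrite mem_index_enum => /(_ isT); rewrite mulf_eq0 expf_eq0 (negPf si) /=.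
  by rewrite subr_eq0 => /eqP.
have xgi : x = g i.
  apply/eqP; rewrite -subr_eq0; apply/eqP/jdot_eq0.
  rewrite !dotjE (jdotC (g i)) xg1 (frame_norm _ fg) jdot_trace xx trx.
  by lra.
by exists (s i); rewrite -[LHS]xy xgi yE (frame_mul_sum fg).
Qed.

(** [quad x] maps into the Peirce 1-space of x, which is a line by [primitive_eigenspace]; pairing
    with x gives the coefficient. *)
Lemma quad_primitive x y : primitive J x -> quad x y = <|x, y|> *: x.
Proof.
move=> px; have [xx _ _] := px.
have [|t qE] := @primitive_eigenspace x (quad x y) px.
  have h := peirce_polynomial xx y; dotted u.
  by move: (congr1 (jdot J ^~ u) h); rewrite /quad /= xx !muljE !dotjE; lra.
have qxx : quad x x = x by rewrite /quad !xx scaler_nat mulr2n addrK.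
have : <|quad x y, x|> = <|y, x|> by rewrite jdot_quad qxx.
by rewrite qE dotZl jdot_trace xx (primitive_trace px) mulr1 => ->; rewrite jdotC.
Qed.

(** * Action of the quadratic representation on multiples of primitive idempotents *)

Section Ray.
Variables (c x : V) (t : R).
Hypotheses (cc : c ** c = c) (px : primitive J x).
Let a := t *: c + (ee - c).
Let alpha := <|x, c|>.

Lemma stretch_square : a ** a = t ^+ 2 *: c + (ee - c).
Proof. by rewrite /a !muljE !jmulr1 jmul1 cc; dotted z; ring. Qed.

Lemma quad_eigen b y s r : b ** y = s *: y -> (b ** b) ** y = r *: y ->
  quad b y = (2 * s ^+ 2 - r) *: y.
Proof.
move=> h1 h2; rewrite /quad h1 h2 mulZr h1.
by rewrite !scalerA -scalerBl -mulrA -expr2.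
Qed.

(* In the Peirce components of [x] with respect to [c], the equations
   [x ** x = x] and [quad x c = alpha *: x] determine all products. *)
Lemma quad_stretch_square :
  quad a x ** quad a x = <|x, a ** a|> *: quad a x.
Proof.
have [xx _ _] := px.
have [x1 [xh [x0 [xE c1 ch c0]]]] := peirce_decomposition cc x.
(* [quad a] acts on the three Peirce components as [t^2], t and 1. *)
have q1 : quad a x1 = t ^+ 2 *: x1.
  rewrite (@quad_eigen a x1 t (t ^+ 2)); first by congr (_ *: _); ring.
    by rewrite /a !muljE jmul1 c1 subrr addr0.
  by rewrite stretch_square !muljE jmul1 c1 subrr addr0.
have qh : quad a xh = t *: xh.
  rewrite (@quad_eigen a xh ((t + 1) / 2) ((t ^+ 2 + 1) / 2)).
  - by congr (_ *: _); field.
  - by rewrite /a !muljE jmul1 ch; dotted z; field.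
  - by rewrite stretch_square !muljE jmul1 ch; dotted z; field.
have q0 : quad a x0 = x0.
  rewrite (@quad_eigen a x0 1 1); first by dotted z; ring.
    by rewrite /a !muljE jmul1 c0 scaler0 subr0 add0r scale1r.
  by rewrite stretch_square !muljE jmul1 c0 scaler0 subr0 add0r scale1r.
have qa : quad a x = t ^+ 2 *: x1 + t *: xh + x0 by rewrite xE !linearD /= q1 qh q0.
have x10 : x1 ** x0 = 0 by apply: (peirce_orthogonal cc).
have c11 : c ** (x1 ** x1) = x1 ** x1 by rewrite (peirce_commute1 cc) // c1.
have c1h : c ** (x1 ** xh) = 2^-1 *: (x1 ** xh).
  by rewrite (peirce_commute1 cc) // ch mulZr.
have ch0 : c ** (xh ** x0) = 2^-1 *: (xh ** x0).
  by rewrite (jC xh) (peirce_commute0 cc) // ch mulZr.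
have c00 : c ** (x0 ** x0) = 0 by rewrite (peirce_commute0 cc) // c0 jmul0r.
have chh := peirce_half_square cc ch ch.
have sq : x1 ** x1 + xh ** xh + x0 ** x0 + 2 *: (x1 ** xh) + 2 *: (xh ** x0) =
    x1 + xh + x0.
  rewrite -xE -[in RHS]xx xE !muljE (jC x0 x1) x10 (jC xh x1) (jC x0 xh).
  by dotted z; lra.
(* Since c acts as 1, 1/2 and 0, applying it once and then twice separates an identity into its
   Peirce components; [pc] is treated likewise below. *)
have sq1 := congr1 (jmul J c) sq.
rewrite !mulDr !mulZr c11 c1h ch0 c00 c1 ch c0 in sq1.
have sq2 := congr1 (jmul J c) sq1.
rewrite !mulDr !mulZr !jmul0r c11 chh c1h ch0 c1 ch in sq2.
have half : x1 ** xh + xh ** x0 = 2^-1 *: xh.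
  by dotted z; move: (congr1 (jdot J ^~ z) sq1) (congr1 (jdot J ^~ z) sq2);
    rewrite /= !dotjE; lra.
(* This is [quad x c = alpha *: x], expanded. *)
have pc : 2 *: (x1 ** x1) + xh ** xh + 2 *: (x1 ** xh) - x1 =
    alpha *: (x1 + xh + x0).
  rewrite -xE -(quad_primitive c px) /quad xx.
  have -> : x ** c = x1 + 2^-1 *: xh by rewrite jC xE !muljE c1 ch c0 addr0.
  rewrite [in RHS]xE !muljE (jC x0 x1) x10 (jC xh x1) (jC x0 xh).
  by dotted z; move: (congr1 (jdot J ^~ z) half); rewrite /= !dotjE; lra.
have pc1 := congr1 (jmul J c) pc.
rewrite !mulDr !mulNr !mulZr !mulDr c11 c1h c1 ch c0 in pc1.
have pc2 := congr1 (jmul J c) pc1.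
rewrite !mulDr !mulNr !mulZr !mulDr !mulZr c11 chh c1h c1 ch !jmul0r in pc2.
have sum1 : x1 ** x1 + c ** (xh ** xh) = x1.
  by dotted z; move: (congr1 (jdot J ^~ z) sq1) (congr1 (jdot J ^~ z) sq2);
    rewrite /= !dotjE; lra.
have h1h : x1 ** xh = (alpha / 2) *: xh.
  by dotted z; move: (congr1 (jdot J ^~ z) pc1) (congr1 (jdot J ^~ z) pc2);
    rewrite /= !dotjE; lra.
rewrite h1h in half pc1 pc sq.
have h11 : x1 ** x1 = alpha *: x1.
  by dotted z; move: (congr1 (jdot J ^~ z) pc1) (congr1 (jdot J ^~ z) sum1);
    rewrite /= !dotjE; lra.
rewrite h11 in pc sq.
have hhh : xh ** xh = (1 - alpha) *: x1 + alpha *: x0.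
  by dotted z; move: (congr1 (jdot J ^~ z) pc); rewrite /= !dotjE; lra.
have hh0 : xh ** x0 = ((1 - alpha) / 2) *: xh.
  by dotted z; move: (congr1 (jdot J ^~ z) half); rewrite /= !dotjE; lra.
rewrite hhh hh0 in sq.
have h00 : x0 ** x0 = (1 - alpha) *: x0.
  by dotted z; move: (congr1 (jdot J ^~ z) sq); rewrite /= !dotjE; lra.
have -> : <|x, a ** a|> = t ^+ 2 * alpha + (1 - alpha).
  by rewrite stretch_square !dotjE (primitive_trace px).
rewrite qa !muljE (jC x0 x1) x10 (jC xh x1) (jC x0 xh) h11 h1h hhh hh0 h00.
by dotted z; field.
Qed.

(** The trace of [quad a x] is b. If b is nonzero, dividing by it gives an idempotent of trace 1; if
    b = 0, then [quad a x] has square zero and so vanishes. *)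
Lemma quad_stretch_ray : exists b q, [/\ 0 <= b, primitive J q & quad a x = b *: q].
Proof.
have [xx _ _] := px; set b := <|x, a ** a|>.
have bE : b = t ^+ 2 * alpha + (1 - alpha).
  by rewrite /b stretch_square !dotjE (primitive_trace px).
have alpha0 : 0 <= alpha by exact: jdot_idempotent_ge0.
have alpha1 : alpha <= 1.
  rewrite -subr_ge0 -(primitive_trace px) -dotNr -dotDr.
  apply: jdot_idempotent_ge0 => //.
  by rewrite !muljE !jmulr1 jmul1 cc; dotted z; ring.
have b0 : 0 <= b by rewrite bE addr_ge0 ?subr_ge0 // mulr_ge0 ?sqr_ge0.
have sq := quad_stretch_square; rewrite -/b in sq.
have [bz|bn] := eqVneq b 0.
  exists 0, x; split=> //; rewrite scale0r; apply: jdot_eq0.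
  by rewrite jdot_trace sq bz scale0r dot0l.
exists b, (b^-1 *: quad a x); split=> //; last by rewrite scalerA divff ?scale1r.
apply: primitive_of_trace.
  by rewrite mulZl mulZr sq !scalerA divfK // mulrC.
by rewrite dotZl jdot_quad quad1r -/b mulVf.
Qed.

End Ray.

(** The value b = 0 is allowed because [quad a] may be singular. *)
Definition ray x : Prop := exists b q, [/\ 0 <= b, primitive J q & x = b *: q].

Lemma quad_ray a x : ray x -> ray (quad a x).
Proof.
have [_ [g fg]] := spectral a; move: (tnth (eigenvalues J a)) => s aE.
(* Coordinates outside r are replaced by 1: an empty r gives the unit, and each new k composes with
   the stretch along [g k]. *)
suff h (r : seq 'I_(jrank J)) : uniq r ->
    ray x -> ray (quad (\sum_k (if k \in r then s k else 1) *: g k) x).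
  move=> /(h _ (index_enum_uniq _)); rewrite aE.
  by under eq_bigr do rewrite mem_index_enum.
elim: r => [_|k r IHr /= /andP[kr ur] /(IHr ur)].
  have -> : \sum_k (if k \in [::] then s k else 1) *: g k = ee.
    by rewrite -(frame_sum fg); apply: eq_bigr => k _; rewrite scale1r.
  by rewrite /quad !jmul1 scaler_nat mulr2n addrK.
have -> : quad (\sum_j (if j \in k :: r then s j else 1) *: g j) x =
   quad (s k *: g k + (ee - g k)) (quad (\sum_j (if j \in r then s j else 1) *: g j) x).
  have -> : s k *: g k + (ee - g k) = \sum_j (if j == k then s k else 1) *: g j.
    rewrite -(frame_sum fg) (bigD1 k) //= [RHS](bigD1 k) //= eqxx (addrC (g k)) addrK.
    by congr (_ + _); apply: eq_bigr => j /negPf->; rewrite scale1r.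
  rewrite (quad_frame_comp fg); congr (quad _ x); apply: eq_bigr => j _.
  rewrite inE; have [->|] := eqVneq j k; first by rewrite (negPf kr) mulr1.
  by rewrite mul1r.
case=> b [q [b0 pq ->]]; rewrite linearZ /=.
have [b' [q' [b'0 pq' ->]]] := quad_stretch_ray (s k) (frame_idempotent fg k) pq.
by exists (b * b'), q'; rewrite scalerA mulr_ge0.
Qed.

Lemma ray_dot_ge0 x c : ray x -> c ** c = c -> 0 <= <|x, c|>.
Proof.
case=> b [q [b0 [qq _ _] ->]] cc.
by rewrite dotZl mulr_ge0 ?jdot_idempotent_ge0.
Qed.

Lemma primitive_ray p : primitive J p -> ray p.
Proof. by exists 1, p; rewrite ler01 scale1r. Qed.

Lemma ray_jnneg x : ray x -> jnneg J x.
Proof. by move=> rx; apply/jnnegP => c; exact: ray_dot_ge0. Qed.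

Lemma jdot_jnneg x y : jnneg J x -> jnneg J y -> 0 <= <|x, y|>.
Proof.
move=> /jnnegP x0 y0; have [_ [g fg ->]] := spectral y.
rewrite jdot_sumr sumr_ge0 // => i _; rewrite dotZr mulr_ge0 //.
exact/x0/(frame_idempotent fg).
Qed.

(** * Implications valid in every Euclidean Jordan algebra *)

Lemma correlation_doubly_stochastic (g : 'I_(jrank J) -> V) C (T : {linear V -> V}) :
  jordan_frame J g -> (forall x, T x = schur J g C x) ->
  correlation C -> doubly_stochastic J T.
Proof.
move=> fg TE [symC posC diagC]; split.
- move=> x x0; have [s CE] := psd_sum_rank1 (conj symC posC).
  have [_ [h fh xE]] := spectral x.
  apply/jnnegP => c cc; rewrite xE linear_sum jdot_suml sumr_ge0 // => i _.
  rewrite linearZ dotZl mulr_ge0 // TE (schurE fg _ symC).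
  (* A sum of rank-one matrices acts as a sum of quadratic representations, each sending the
     primitive [h i] into a ray. *)
  have -> : \sum_k \sum_l C k l *: block_component g k l (h i) =
      \sum_(v <- s) quad (\sum_k v 0 k *: g k) (h i).
    under [RHS]eq_bigr do rewrite -(schur_rank1 fg).
    rewrite [RHS]exchange_big; apply: eq_bigr => k _.
    rewrite [RHS]exchange_big; apply: eq_bigr => l _.
    by rewrite CE summxE scaler_suml.
  rewrite jdot_suml sumr_ge0 // => v _; apply: ray_dot_ge0 => //.
  by apply/quad_ray/primitive_ray; case: fh.
- by rewrite TE schur_unit.
move=> x; rewrite !jtrE -!(jdot_sum_frame fg); apply: eq_bigr => i _.
by rewrite TE jdot_schur // diagC mul1r.
Qed.

(** In the matrix [<|T (h j), g i|>], positivity of T gives the signs, unitality the row sums and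
    trace preservation the column sums. *)
Lemma doubly_stochastic_jmajorized (T : {linear V -> V}) x :
  doubly_stochastic J T -> jmajorized J (T x) x.
Proof.
case=> Tpos T1 Ttr; have [sx [h fh xE]] := spectral x.
have [sTx [g fg TxE]] := spectral (T x).
have frame_jnneg m (f : 'I_m -> V) i : jordan_frame J f -> jnneg J (f i).
  by case=> pf _ _; apply/ray_jnneg/primitive_ray.
apply: (@doubly_stochastic_majorized _ _ _ _ (fun i j => <|T (h j), g i|>)) => //.
- by move=> i j; apply: jdot_jnneg; [apply: Tpos |]; exact: frame_jnneg.
- move=> i; rewrite -jdot_suml -linear_sum (frame_sum fh) T1 jdotC.
  exact: frame_trace.
- by move=> j; rewrite jdot_sum_frame // -jtrE Ttr jtrE (frame_trace _ fh).
move=> i; have := jdot_frame_sum fg (tnth (eigenvalues J (T x))) i.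
rewrite -TxE (frame_norm _ fg) mulr1 => <-.
rewrite {1}xE linear_sum jdot_suml; apply: eq_bigr => j _.
by rewrite linearZ dotZl mulrC.
Qed.

(** Positivity is the lower bound 0 on eigenvalues. Those of [T ee] are at least 1 and have the same
    sum as those of [ee], so all equal 1. *)
Lemma jmajorized_doubly_stochastic (T : {linear V -> V}) :
  (forall x, jmajorized J (T x) x) -> doubly_stochastic J T.
Proof.
move=> maj.
have Ttr x : jtr J (T x) = jtr J x by exact: majorized_sum (maj x).
have low m x : (forall i, m <= tnth (eigenvalues J x) i) ->
    forall i, m <= tnth (eigenvalues J (T x)) i.
  by apply: majorized_lower_bound (maj x); case: (spectral x); case: (spectral (T x)).
split=> //; first by move=> x; exact: low.
have [_ [h fh oneE]] := spectral ee; have [_ [g fg TE]] := spectral (T ee).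
have eig1 i : 1 <= tnth (eigenvalues J (T ee)) i.
  apply: low => {}i; rewrite -[leRHS]mulr1 -{2}(frame_norm i fh).
  by rewrite -(jdot_frame_sum fh) -oneE jdotC (frame_trace _ fh).
have sum0 : \sum_i (tnth (eigenvalues J (T ee)) i - 1) = 0.
  rewrite sumrB -[X in X - _]/(jtr J (T ee)) Ttr jtrE -(jdot_sum_frame fg).
  apply/eqP; rewrite subr_eq0; apply/eqP/eq_bigr => i _.
  by rewrite jdotC (frame_trace _ fg).
rewrite TE -[RHS](frame_sum fg); apply: eq_bigr => i _.
move/eqP: sum0; rewrite psumr_eq0 => [/allP/(_ i)|j _]; last by rewrite subr_ge0.
by rewrite mem_index_enum subr_eq0 => /(_ isT)/eqP ->; rewrite scale1r.
Qed.

(** * Simple algebras *)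

Section Simple.
Variables (g : 'I_(jrank J) -> V) (fg : jordan_frame J g).

(** Both sides equal [<|quad p (g i), g j|>]: the left by associativity of the inner product, the
    right by [quad_primitive]. *)
Lemma jdot_block_component_primitive p i j : primitive J p ->
  <|block_component g i j p, p|> = <|p, g i|> * <|p, g j|>.
Proof.
move=> pp; have [pE _ _] := pp.
have := congr1 (jdot J ^~ (g j)) (quad_primitive (g i) pp).
rewrite /quad pE /= !dotjE => <-.
rewrite (jdot_assoc J (g i)) (jdot_assoc J p (p ** g i)) (jC (g i) p) (jC (g j) p).
rewrite (jdotC (p ** g i) (p ** g j)) (jdot_assoc J p (g i) p) pE; congr (_ - _).
rewrite (jC p) jdot_assoc; have [->|ij] := eqVneq i j.
  by rewrite (frame_idempotent fg) mul1r jdotC.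
by rewrite mul0r (frame_orthogonal fg ij) dot0r.
Qed.

(** The square lies in the 1-space of [g i + g j], and its product with either idempotent lies on
    the line of that idempotent; pairing fixes the coefficients. *)
Lemma off_block_square i j u : i != j -> peirce_block g i j u ->
  u ** u = (<|u, u|> / 2) *: (g i + g j).
Proof.
move=> ij bu.
have half k l v : k != l -> peirce_block g k l v -> g k ** v = 2^-1 *: v.
  by move=> kl ->; rewrite eqxx (negPf kl) addr0 div1r.
have ji : j != i by rewrite eq_sym.
have gi := half _ _ _ ij bu.
have gj : g j ** u = 2^-1 *: u.
  by apply: half ji _ => k; rewrite bu addrC.
have coord k : g k ** u = 2^-1 *: u ->
    g k ** (u ** u) = (<|u, u|> / 2) *: g k.
  move=> gk; have gg := frame_idempotent fg k.
  have pk : primitive J (g k) by case: fg.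
  have [t tE] := primitive_eigenspace pk (peirce_half_square gg gk gk).
  rewrite tE; congr (_ *: _).
  have : <|g k ** (u ** u), g k|> = <|u, u|> / 2.
    by rewrite jdot_assoc gg jdot_assoc (jC u) gk dotZr mulrC.
  by rewrite tE dotZl (frame_norm _ fg) mulr1.
have sumu : (g i + g j) ** u = u.
  by rewrite mulDl gi gj; dotted z; field.
have gij : (g i + g j) ** (g i + g j) = g i + g j.
  by rewrite !muljE !(frame_idempotent fg) !(frame_orthogonal fg) // addr0 add0r.
have -> : u ** u = (g i + g j) ** (u ** u).
  by rewrite (peirce_commute1 gij) // sumu.
by rewrite mulDl !coord // scalerDr.
Qed.

(* Extending the support of [p] from [i] to [j]: apply the quadratic
   representation of [ee + u] with [u] in the (i, j) block. *)
Lemma extend_support p i j u : primitive J p -> i != j -> 0 < <|p, g i|> ->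
  <|p, g j|> = 0 -> peirce_block g i j u -> u != 0 ->
  exists q, [/\ primitive J q, 0 < <|q, g j|> &
    forall k, 0 < <|p, g k|> -> 0 < <|q, g k|>].
Proof.
move=> pp ij pi pj bu u0; have [ppE _ _] := pp.
have ji : j != i by rewrite eq_sym.
set s := <|u, u|> / 2; have s0 : 0 < s by rewrite divr_gt0 ?jdot_gt0 ?ltr0n.
have uu := off_block_square ij bu; rewrite -/s in uu.
have gi : g i ** u = 2^-1 *: u by rewrite bu eqxx (negPf ij) addr0 div1r.
have gj : g j ** u = 2^-1 *: u by rewrite bu eqxx (negPf ji) add0r div1r.
have pgj : p ** g j = 0.
  by apply: jdot_idempotent_eq0 => //; exact: (frame_idempotent fg).
(* Hence the terms of [quad (ee + u)] that are linear in u contribute nothing to [dotq]. *)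
have pu : <|p, u|> = 0.
  have -> : u = 2 *: (g j ** u) by rewrite gj scalerA divff ?scale1r ?pnatr_eq0.
  by rewrite dotZr jdot_mulr jC pgj dot0l mulr0.
have q_eq y : quad (ee + u) y = y + 2 *: (u ** y) + 2 *: (u ** (u ** y)) - (u ** u) ** y.
  by dotted z; rewrite /quad !muljE !jmulr1 !jmul1 !dotjE; ring.
have dotq k : <|quad (ee + u) p, g k|> =
    <|p, g k|> + (k == i)%:R * (s * <|p, g j|>) + (k == j)%:R * (s * <|p, g i|>).
  rewrite jdot_quad q_eq (jC u (g k)) bu uu !muljE uu.
  have [->|ki] := eqVneq k i.
    rewrite (negPf ij) (frame_idempotent fg) (frame_orthogonal fg ji).
    by rewrite !dotjE pu /=; field.
  have [->|kj] := eqVneq k j.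
    rewrite (frame_idempotent fg) (frame_orthogonal fg ij).
    by rewrite !dotjE pu /=; field.
  rewrite !(frame_orthogonal fg) 1?eq_sym // !dotjE.
  by rewrite /=; field.
have [b [q [b0 pq qE]]] := quad_ray (ee + u) (primitive_ray pp).
have dotq_gt0 k : 0 < <|quad (ee + u) p, g k|> -> 0 < <|q, g k|>.
  rewrite qE dotZl; move: b0; rewrite le_eqVlt => /orP[/eqP<-|b0].
    by rewrite mul0r ltxx.
  by rewrite pmulr_rgt0.
exists q; split=> // [|k pk]; apply: dotq_gt0; rewrite dotq pj.
  by rewrite (negPf ji) eqxx mul0r mul1r !add0r mulr_gt0.
rewrite mulr0 mulr0 addr0 (lt_le_trans pk) // lerDl mulr_ge0 ?ler0n //.
by rewrite mulr_ge0 ?ltW.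
Qed.

Hypothesis simpleJ : simple J.

(** Otherwise the Peirce 1-space of the sum of the [g k] over S would be an ideal, neither zero nor
    everything. *)
Lemma simple_connected (S : {set 'I_(jrank J)}) : S != set0 -> S != setT ->
  exists i j u, [/\ i \in S, j \notin S, peirce_block g i j u & u != 0].
Proof.
move=> /set0Pn[i0 i0S] ST.
apply: contrapT => noblock.
have zero i j u : i \in S -> j \notin S -> peirce_block g i j u -> u = 0.
  move=> iS jS bu; apply/eqP/negPn/negP => u0.
  by apply: noblock; exists i, j, u.
pose c := \sum_k ((k \in S)%:R : R) *: g k.
have cc : c ** c = c.
  rewrite /c (frame_sum_mul fg); apply: eq_bigr => k _.
  by case: (k \in S); rewrite /= ?mulr1 ?mulr0.
pose I := passmx.leigenspace (linfun (jmul J c)) 1.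
have memI x : (x \in I) = (c ** x == x) by rewrite mem_leigenspace lfunE scale1r.
have cg k : c ** g k = ((k \in S)%:R : R) *: g k.
  by rewrite jC (frame_mul_sum fg).
have idI : ideal J I.
  move=> x y; rewrite !memI => /eqP cx; apply/eqP.
  rewrite -(block_component_sum fg y) jmul_sumr jmul_sumr; apply: eq_bigr => i _.
  rewrite jmul_sumr jmul_sumr; apply: eq_bigr => j _.
  have by_ := block_component_block fg i j y.
  move: (block_component g i j y) by_ => w bw.
  have cw : c ** w = (((i \in S)%:R + (j \in S)%:R) / 2) *: w by exact: block_mul.
  have bw' : peirce_block g j i w by move=> k; rewrite bw addrC.
  have [iS|iS] := boolP (i \in S); have [jS|jS] := boolP (j \in S).
  - rewrite (peirce_commute1 cc) // cw iS jS (_ : _ / _ = 1) ?scale1r //=; lra.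
  - by rewrite (zero _ _ _ iS jS bw) !jmul0r.
  - by rewrite (zero _ _ _ jS iS bw') !jmul0r.
  rewrite (peirce_orthogonal cc cx) ?jmul0r //.
  by rewrite cw (negPf iS) (negPf jS) addr0 mul0r scale0r.
have [_ /(_ I idI)[I0|IT]] := simpleJ.
  have : g i0 \in I by rewrite memI cg i0S scale1r.
  by rewrite I0 memv0 => /eqP/(frame_neq0 fg).
case/negP: ST; apply/eqP/setP => k; rewrite inE.
have : g k \in I by rewrite IT memvf.
rewrite memI cg; case: (k \in S) => //=; rewrite scale0r eq_sym => /eqP.
by move/(frame_neq0 fg).
Qed.

(** Starting from a member of the frame, the support grows by [extend_support] along a block leaving
    it, as long as it is not full. *)
Lemma full_support : exists2 p, primitive J p & forall i, 0 < <|p, g i|>.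
Proof.
pose supp p := [set i | 0 < <|p, g i|>].
have dot_ge0 p i : primitive J p -> 0 <= <|p, g i|>.
  by case=> pp _ _; apply: jdot_idempotent_ge0 => //; exact: (frame_idempotent fg).
suff [p pp] : exists2 p, primitive J p & supp p = setT.
  by move=> /setP sp; exists p => // i; move: (sp i); rewrite !inE.
suff grow m : (m <= jrank J)%N ->
    exists2 p, primitive J p & supp p != set0 /\ (m <= #|supp p|)%N.
  have [p pp [_ sp]] := grow _ (leqnn _); exists p => //.
  by apply/eqP; rewrite eqEcard subsetT cardsT card_ord.
elim: m => [_|m IHm lt_m].
  have [i0] : exists i0 : 'I_(jrank J), true.
    apply: contrapT => noi; case: simpleJ => V0 _; apply: V0; apply/eqP.
    rewrite -subv0; apply/subvP => x _; rewrite memv0 -(jmul1 J x) -(frame_sum fg).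
    by rewrite big1 ?jmul0l // => i; case: noi; exists i.
  exists (g i0); first by case: fg.
  by split=> //; apply/set0Pn; exists i0; rewrite inE (frame_norm _ fg).
have [p pp [sp0 sp]] := IHm (ltnW lt_m).
have [spT|spT] := eqVneq (supp p) setT.
  by exists p => //; split=> //; rewrite spT cardsT card_ord.
have [i [j [u [iS jS bu u0]]]] := simple_connected sp0 spT.
move: iS jS; rewrite !inE => iS jS.
have ij : i != j by apply: contraNneq jS => <-.
have pj : <|p, g j|> = 0.
  by apply/eqP; move: (dot_ge0 p j pp); rewrite le_eqVlt (negPf jS) orbF eq_sym.
have [q [pq qj qk]] := extend_support pp ij iS pj bu u0.
exists q => //; split; first by apply/set0Pn; exists j; rewrite inE.
apply: leq_ltn_trans sp _; apply/proper_card/properP; split.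
  by apply/subsetP => k; rewrite !inE => /qk.
by exists j; rewrite inE // -leNgt pj.
Qed.

Lemma positive_correlation C (T : {linear V -> V}) : C^T = C ->
  (forall x, T x = schur J g C x) -> doubly_stochastic J T -> correlation C.
Proof.
move=> symC TE [Tpos T1 _]; split=> // [v|i]; last first.
  have := jdot_schur fg ee i symC; rewrite -TE T1 jdotC (frame_trace _ fg).
  by rewrite mulr1.
have [p pp p_gt0] := full_support.
(* The denominators cancel the factors [<|p, g i|> * <|p, g j|>] from
   [jdot_block_component_primitive]. *)
pose w k := v 0 k / <|p, g k|>; pose a := \sum_k w k *: g k.
have Tp0 : jnneg J (T p) by apply/Tpos/ray_jnneg/primitive_ray.
have ap0 : jnneg J (quad a p) by apply/ray_jnneg/quad_ray/primitive_ray.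
have := jdot_jnneg Tp0 ap0.
rewrite -jdot_quad TE (schurE fg) // linear_sum jdot_suml.
suff -> : (v *m C *m v^T) 0 0 =
    \sum_i <|quad a (\sum_j C i j *: block_component g i j p), p|> by [].
rewrite mxE; under eq_bigr do rewrite !mxE mulr_suml.
rewrite exchange_big; apply: eq_bigr => i _.
rewrite linear_sum jdot_suml; apply: eq_bigr => j _.
rewrite linearZ /= (quad_block fg _ (block_component_block fg i j p)) !dotZl.
rewrite jdot_block_component_primitive // /w.
by field; apply/andP; split; apply/lt0r_neq0/p_gt0.
Qed.

End Simple.
End Trace.
End JordanAlgebra.

Theorem theorem3p1 (R : realType) (V : vectType R) (J : euclidean_jordan V)
  (trace_dot : forall x y : V, jdot J x y = jtr J (jmul J x y))
  (n : nat) (rank_n : jrank J = n)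
  (e : 'I_n -> V) (frame_e : jordan_frame J e)
  (C : 'M[R]_n) (symC : (C^T)%R = C)
  (T : {linear V -> V}) (T_schur : forall x : V, T x = schur J e C x) :
  (correlation C -> doubly_stochastic J T) /\
  (doubly_stochastic J T <-> forall x : V, jmajorized J (T x) x) /\
  (simple J -> (forall x : V, jmajorized J (T x) x) -> correlation C).
Proof.
(* The frame [e] serves twice: as a frame whose length is the rank, and as the frame of the Schur
   product. *)
subst n; split.
  exact: (correlation_doubly_stochastic trace_dot frame_e frame_e T_schur).
have c_to_b := jmajorized_doubly_stochastic trace_dot frame_e (T := T).
split; first by split=> // dsT x; exact: (doubly_stochastic_jmajorized trace_dot frame_e).
move=> simpleJ /c_to_b.
exact: (positive_correlation trace_dot frame_e frame_e simpleJ symC T_schur).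
Qed.
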